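(* Let $X$ be a real Banach space and let $D\subset X^*$ be an unbounded set. For each $f\in D$, define $S_f=\{x\in X:\ f(x)\geq 1\}$. Then there exist $x\in S_X$ and an infinite set $N\subset D$ such that $x\in \operatorname{int} S_f$ whenever $f\in N$.
   Context: $X^*$ is the dual Banach space of $X$ (''unbounded'' means unbounded in the dual norm), $S_X=\{x\in X:\|x\|=1\}$ is the unit sphere of $X$, and $\operatorname{int}$ denotes the interior in the norm topology of $X$. *)

(* Defs.v *)
From HB Require Import structures.
From mathcomp Require Import all_boot all_order all_algebra.
From mathcomp Require Import all_classical all_reals all_analysis.

Set Implicit Arguments.
Unset Strict Implicit.
Unset Printing Implicit Defensive.

Import Order.TTheory GRing.Theory Num.Theory.
Import numFieldNormedType.Exports.

Local Open Scope classical_set_scope.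
Local Open Scope ring_scope.

(* The scalar field is [R^o], i.e. [R] seen as a normed space over itself, so
   that [linear] and [continuous] both refer to the intended structures. *)
Definition dual (R : realType) (X : normedModType R) : set (X -> R^o) :=
  [set f | linear f /\ continuous f].

(* [sup] is real-valued, with value 0 on sets that are not bounded above; by
   [has_sup_dual_norm] it is a genuine supremum whenever [f] is in [dual X]. *)
Definition dual_norm (R : realType) (X : normedModType R) (f : X -> R^o) : R :=
  sup [set `|f x| | x in [set x : X | `|x| <= 1]].

Definition dual_unbounded (R : realType) (X : normedModType R)
    (D : set (X -> R^o)) : Prop :=
  ~ has_ubound [set dual_norm f | f in D].

Definition unit_sphere (R : realType) (X : normedModType R) : set X :=
  [set x | `|x| = 1].

Definition upper_slice (R : realType) (X : normedModType R) (f : X -> R^o) :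
    set X :=
  [set x | 1 <= f x].

Arguments dual {R} X.
Arguments unit_sphere {R} X.

Lemma has_sup_dual_norm (R : realType) (X : normedModType R) (f : X -> R^o) :
  dual X f -> has_sup [set `|f x| | x in [set x : X | `|x| <= 1]].
Proof.
move=> [lf cf]; split.
  by exists `|f 0|, 0 => //=; rewrite normr0.
pose g : {linear X -> R^o} := HB.pack f (GRing.isLinear.Build _ _ _ _ _ lf).
have /linear_boundedP : bounded_near g (nbhs (0 : X)).
  exact: (@continuous_linear_bounded R X R^o 0 g (cf 0)).
move=> /pinfty_ex_gt0[M M0 HM].
exists M => _ [x /= x1 <-]; apply: le_trans (HM x) _.
by rewrite ler_piMr// ltW.
Qed.

(* Main.v *)
Require Import Defs.
From mathcomp Require Import all_boot all_order all_algebra.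
From mathcomp Require Import all_classical all_reals all_analysis.
Import Order.TTheory GRing.Theory Num.Theory.
Import numFieldNormedType.Exports.
Local Open Scope classical_set_scope.
Local Open Scope ring_scope.

(** If each [x] in the unit sphere satisfied [1 < f x] for only finitely many
    [f] in [D], then, applying this to [x] and [- x], the set [D] would be
    pointwise bounded, hence norm bounded by the Banach-Steinhaus theorem. So
    [1 < f x] for infinitely many [f] in [D] and some unit vector [x], and [x]
    is interior to [S_f] for each such [f] by continuity. *)

Lemma finite_has_ubound (R : realType) (E : set R) :
  finite_set E -> has_ubound E.
Proof.
move=> /finite_seqP[s ->]; exists (\big[Num.max/0]_(y <- s) y) => y /= ys.
exact: le_bigmax_seq ys _.
Qed.

Lemma dualZ {R : realType} {X : normedModType R} {f : X -> R^o} :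
  dual X f -> forall a x, f (a *: x) = a * f x.
Proof. by move=> [lf _]; exact: GRing.scalable_linear lf. Qed.

Lemma dual_norm_le {R : realType} {X : normedModType R} {f : X -> R^o} x :
  dual X f -> `|x| <= 1 -> `|f x| <= dual_norm f.
Proof.
move=> df x1; apply: ub_le_sup; last by exists x.
by have [] := has_sup_dual_norm df.
Qed.

Lemma normr_normalize {R : realType} {X : normedModType R} (x : X) :
  x != 0 -> `| `|x|^-1 *: x| = 1.
Proof. by move=> x0; rewrite normrZ normfV normr_id mulVf ?normr_eq0. Qed.

Lemma dual_normalize {R : realType} {X : normedModType R} {f : X -> R^o} x :
  dual X f -> x != 0 -> `|f x| = `|x| * `|f (`|x|^-1 *: x)|.
Proof.
by move=> df x0; rewrite (dualZ df) normrM normfV normr_id mulVKf ?normr_eq0.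
Qed.

(** By homogeneity, [r * dual_norm f] bounds [f] on the ball of radius [r]; this is the form of
    boundedness that [Banach_Steinhauss] asks of each functional. *)
Lemma dual_bounded_fun_norm (R : realType) (X : normedModType R)
    (f : X -> R^o) :
  dual X f -> bounded_fun_norm f.
Proof.
move=> df r; exists (r * dual_norm f) => x xr.
have [->|x0] := eqVneq x 0; last first.
  rewrite (dual_normalize x df x0) ler_pM//.
  by rewrite dual_norm_le// normr_normalize.
(* The sign of [r] is not given; [r] is nonnegative because the norm of [x] is at most [r]. *)
rewrite -(scale0r 0) (dualZ df) mul0r normr0 mulr_ge0//.
  exact: le_trans xr.
by apply: le_trans (dual_norm_le 0 df _); rewrite ?normr0.
Qed.

(** Since the inequality is strict, the closed half-line from 1 is a neighbourhood of [f x], and its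
    preimage under [f] is the slice. *)
Lemma interior_upper_slice (R : realType) (X : normedModType R)
    (f : X -> R^o) (x : X) :
  dual X f -> 1 < f x -> interior (upper_slice f) x.
Proof.
move=> [_ cf] fx1; apply: (cf x [set y | 1 <= y]).
by apply: filterS (lt_nbhsr fx1) => y /ltW.
Qed.

Lemma uniform_bounded_dual_norm (R : realType) (X : normedModType R)
    (D : set (X -> R^o)) :
  uniform_bounded D -> has_ubound [set dual_norm f | f in D].
Proof.
move=> /(_ 1)[M DM]; exists M => _ [f Df <-]; apply: ge_sup.
  by exists `|f 0|, 0 => //=; rewrite normr0.
by move=> _ [x x1 <-]; exact: DM.
Qed.

Lemma finite_pointwise_bounded (R : realType) (X : normedModType R)
    (D : set (X -> R^o)) :
  D `<=` dual X ->
  (forall x, unit_sphere X x -> finite_set [set f | D f /\ 1 < f x]) ->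
  pointwise_bounded D.
Proof.
move=> hD finD x; have [->|x0] := eqVneq x 0.
  exists 0 => f Df.
  by rewrite -(scale0r 0) (dualZ (hD _ Df)) mul0r normr0.
set u := `|x|^-1 *: x; have u1 : `|u| = 1 by exact: normr_normalize.
(* [A] collects the [f] in [D] with absolute value above 1 at [u]; it is finite because [u] and
   [- u] are both unit vectors. *)
set A := [set f | D f /\ 1 < f u] `|` [set f | D f /\ 1 < f (- u)].
have : finite_set [set `|f u| | f in A].
  by apply/finite_image; rewrite finite_setU; split; apply: finD;
    rewrite /unit_sphere/= ?normrN.
move=> /finite_has_ubound[M AM].
(* At [u], [M] bounds the members of [A] and 1 bounds all others; the factor undoes the
   normalization of [x]. *)
exists (`|x| * Num.max M 1) => f Df.
rewrite (dual_normalize x (hD _ Df) x0) -/u ler_wpM2l//.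
rewrite le_max; have [//|fu1] := leP `|f u| 1; first by rewrite orbT.
rewrite orbF; apply: AM; exists f => //.
move: fu1; rewrite lter_normr => /orP[|] fu1; [left|right] => //.
by split=> //; rewrite -scaleN1r (dualZ (hD _ Df)) mulN1r.
Qed.

Theorem proposition2p4 (R : realType) (X : completeNormedModType R)
    (D : set (X -> R^o)) (hD : D `<=` dual X) (hunb : dual_unbounded D) :
  exists (x : X) (N : set (X -> R^o)),
    [/\ unit_sphere X x, N `<=` D, infinite_set N &
        forall f, N f -> interior (upper_slice f) x].
Proof.
have [x x1 infD] : exists2 x, unit_sphere X x &
    infinite_set [set f | D f /\ 1 < f x].
  apply: contra_notP hunb => noinf.
  (* Completeness of [X] enters here, turning pointwise bounds into a uniform bound on balls. *)
  apply: uniform_bounded_dual_norm; apply: Banach_Steinhauss.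
    by move=> f /hD df; split; [exact: dual_bounded_fun_norm|have [] := df].
  apply: finite_pointwise_bounded => // x x1.
  by apply: contrapT => infx; apply: noinf; exists x.
exists x, [set f | D f /\ 1 < f x]; split => //; first by move=> f [].
by move=> f [/hD df fx1]; exact: interior_upper_slice.
Qed.
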